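(* $\mathsf{EZF}$ plus the stability of the membership relation implies the stability of the negation of the membership relation. That is, $\mathsf{EZF}$ together with $\Box\,[\forall x,y\,(x\in y\Rightarrow\Box(x\in y))]$ proves $\Box\,[\forall x,y\,(x\notin y\Rightarrow\Box(x\notin y))]$.
   Context: Quantified modal logic. Modal formulas are built from atomic formulas and $\bot$ by $\wedge,\vee,\Rightarrow,\forall,\exists,\Box$; $\neg\varphi$ is $\varphi\Rightarrow\bot$. The Hilbert system $Q_{eq}.\mathsf{S4}$ has as axioms: all instances of classical propositional tautologies; $\Box(\varphi\Rightarrow\psi)\Rightarrow(\Box\varphi\Rightarrow\Box\psi)$; $\Box\varphi\Rightarrow\varphi$; $\Box\varphi\Rightarrow\Box\Box\varphi$; $(\forall x\,\varphi)\Leftrightarrow\varphi$ for $x$ not free in $\varphi$; $[\forall x(\varphi\Rightarrow\psi)]\Rightarrow[(\forall x\,\varphi)\Rightarrow(\forall x\,\psi)]$; $\forall x\forall y\,\varphi\Leftrightarrow\forall y\forall x\,\varphi$; $(\forall x\,\varphi(x))\Rightarrow\varphi(y)$; $\exists x\,\varphi\Leftrightarrow\neg\forall x\neg\varphi$; $t=t$; $s=t\Rightarrow(\varphi(t)\Rightarrow\varphi(s))$ for terms $s,t$. Its rules are modus ponens, universal generalization (from $\varphi$ infer $\forall x\,\varphi$) and necessitation (from $\varphi$ infer $\Box\varphi$). The theory $\mathsf{EZF}$, in the signature with one binary relation symbol $\in$, is built from $Q_{eq}.\mathsf{S4}$ by adding the following axioms, where in schemas $\varphi$ is any modal formula, possibly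 with parameters, and $\forall y\in x$, $\exists y\in x$ are the usual abbreviations: I. (Modal Extensionality) $\forall x\,\forall y\,(\Box(\forall z\,(z\in x\Leftrightarrow z\in y))\Rightarrow x=y)$. II. (Induction Schema) $[\forall x\,((\forall y\in x\;\varphi(y))\Rightarrow\varphi(x))]\Rightarrow[\forall x\,\varphi(x)]$. III. (Scedrov's Modal Foundation) $[\Box\,\forall x\,(\Box(\forall y\in x\;\varphi(y))\Rightarrow\varphi(x))]\Rightarrow[\Box\,\forall x\,\varphi(x)]$. IV. (Pairing) $\forall x,y\,\exists z\,\Box(\forall u\,(u\in z\Leftrightarrow(u=x\vee u=y)))$. V. (Unions) $\forall x\,\exists y\,\Box(\forall z\,(z\in y\Leftrightarrow\exists v\,(v\in x\wedge z\in v)))$. VI. (Comprehension) $\forall x\,\exists y\,\Box(\forall z\,(z\in y\Leftrightarrow(z\in x\wedge\varphi(z))))$. VII. (Modal Power Set) $\forall x\,\exists y\,\Box\,\forall z\,(z\in y\Leftrightarrow\Box(\forall u\,(u\in z\Rightarrow u\in x)))$. VIII. (Infinity) $\exists u\,\Box[\exists y\in u\,\Box(\forall z\;z\notin y)\wedge(\forall y\in u\,\exists z\in u\,\Box\,\forall v\,(v\in z\Leftrightarrow(v\in y\vee v=y)))]$. IX. (Modal Collection) $[\Box(\forall y\in u\,\exists z\,\varphi(y,z))]\Rightarrow[\exists x\,\Box\,\forall y\in u\,\exists z\,(\Box(z\in x\wedge\varphi(y,z)))]$. X. (Collection) $[\forall y\in u\,\exists z\,\varphi(y,z)]\Rightarrow[\exists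 x\,\forall y\in u\,\exists z\in x\;\varphi(y,z)]$. *)

(* Defs.v *)
From mathcomp Require Import all_boot.

Set Implicit Arguments.
Unset Strict Implicit.
Unset Printing Implicit Defensive.

Definition var := nat.

(* The signature has no function symbols, so the terms are the variables. *)
Inductive formula : Type :=
| FBot
| FEq (x y : var)
| FMem (x y : var)
| FAnd (A B : formula)
| FOr (A B : formula)
| FImp (A B : formula)
| FAll (x : var) (A : formula)
| FEx (x : var) (A : formula)
| FBox (A : formula).

Declare Scope formula_scope.
Delimit Scope formula_scope with F.
Bind Scope formula_scope with formula.

Definition FNeg (A : formula) : formula := FImp A FBot.
Definition FIff (A B : formula) : formula := FAnd (FImp A B) (FImp B A).

(* As for booleans, [==>] binds more tightly than [~], [/\] and [\/]. *)
Notation "A /\ B" := (FAnd A B) : formula_scope.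
Notation "A \/ B" := (FOr A B) : formula_scope.
Notation "A ==> B" := (FImp A B) : formula_scope.
Notation "A <-> B" := (FIff A B) : formula_scope.
Notation "~ A" := (FNeg A) : formula_scope.

Local Open Scope formula_scope.

Definition FAllIn (y x : var) (A : formula) : formula := FAll y (FMem y x ==> A).
Definition FExIn (y x : var) (A : formula) : formula := FEx y (FMem y x /\ A).

Fixpoint is_free (x : var) (A : formula) : bool :=
  match A with
  | FBot => false
  | FEq y z | FMem y z => (x == y) || (x == z)
  | FAnd B C | FOr B C | FImp B C => is_free x B || is_free x C
  | FAll y B | FEx y B => (x != y) && is_free x B
  | FBox B => is_free x B
  end.

(* [subst x t A] replaces the free occurrences of [x] in [A] by [t] without
   renaming bound variables; it is only meaningful under [free_for t x A]. *)
Fixpoint subst (x t : var) (A : formula) : formula :=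
  let s y := if y == x then t else y in
  match A with
  | FBot => FBot
  | FEq y z => FEq (s y) (s z)
  | FMem y z => FMem (s y) (s z)
  | FAnd B C => FAnd (subst x t B) (subst x t C)
  | FOr B C => FOr (subst x t B) (subst x t C)
  | FImp B C => FImp (subst x t B) (subst x t C)
  | FAll y B => FAll y (if y == x then B else subst x t B)
  | FEx y B => FEx y (if y == x then B else subst x t B)
  | FBox B => FBox (subst x t B)
  end.

(* No free occurrence of [x] in [A] lies in the scope of a quantifier
   binding [t]. *)
Fixpoint free_for (t x : var) (A : formula) : bool :=
  match A with
  | FBot | FEq _ _ | FMem _ _ => true
  | FAnd B C | FOr B C | FImp B C => free_for t x B && free_for t x C
  | FAll y B | FEx y B =>
      ~~ ((x != y) && is_free x B) || ((t != y) && free_for t x B)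
  | FBox B => free_for t x B
  end.

Inductive pform : Type :=
| PVar (n : nat)
| PBot
| PAnd (p q : pform)
| POr (p q : pform)
| PImp (p q : pform).

Fixpoint peval (v : nat -> bool) (p : pform) : bool :=
  match p with
  | PVar n => v n
  | PBot => false
  | PAnd p q => peval v p && peval v q
  | POr p q => peval v p || peval v q
  | PImp p q => peval v p ==> peval v q
  end%B.

Definition tautology (p : pform) : Prop := forall v, peval v p.

Fixpoint pinst (s : nat -> formula) (p : pform) : formula :=
  match p with
  | PVar n => s n
  | PBot => FBot
  | PAnd p q => FAnd (pinst s p) (pinst s q)
  | POr p q => FOr (pinst s p) (pinst s q)
  | PImp p q => FImp (pinst s p) (pinst s q)
  end.

Inductive QeqS4_axiom : formula -> Prop :=
| ax_taut p s : tautology p -> QeqS4_axiom (pinst s p)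
| ax_K A B : QeqS4_axiom (FBox (A ==> B) ==> (FBox A ==> FBox B))
| ax_T A : QeqS4_axiom (FBox A ==> A)
| ax_4 A : QeqS4_axiom (FBox A ==> FBox (FBox A))
| ax_all_vacuous x A : ~~ is_free x A -> QeqS4_axiom (FAll x A <-> A)
| ax_all_imp x A B :
    QeqS4_axiom (FAll x (A ==> B) ==> (FAll x A ==> FAll x B))
| ax_all_comm x y A : QeqS4_axiom (FAll x (FAll y A) <-> FAll y (FAll x A))
| ax_all_inst x y A : free_for y x A -> QeqS4_axiom (FAll x A ==> subst x y A)
| ax_ex x A : QeqS4_axiom (FEx x A <-> ~ FAll x (~ A))
| ax_eq_refl t : QeqS4_axiom (FEq t t)
| ax_eq_subst s t x A : free_for s x A -> free_for t x A ->
    QeqS4_axiom (FEq s t ==> (subst x t A ==> subst x s A)).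

(* The non-logical axioms [T] are axioms of the Hilbert system, so that
   generalization and necessitation also apply to their consequences. *)
Inductive provable (T : formula -> Prop) : formula -> Prop :=
| pr_logic A : QeqS4_axiom A -> provable T A
| pr_axiom A : T A -> provable T A
| pr_mp A B : provable T (A ==> B) -> provable T A -> provable T B
| pr_gen x A : provable T A -> provable T (FAll x A)
| pr_nec A : provable T A -> provable T (FBox A).

Definition extend (T : formula -> Prop) (A : formula) : formula -> Prop :=
  fun B => or (T B) (B = A).

(* The variables displayed in an axiom are pairwise distinct, and in the
   schemas a set quantified existentially, or a bound variable substituted
   into [A], is not free in [A]; every other variable may occur in [A] as a
   parameter. *)
Inductive EZF : formula -> Prop :=
| EZF_extensionality x y z : uniq [:: x; y; z] ->
    EZF (FAll x (FAll y
      (FBox (FAll z (FMem z x <-> FMem z y)) ==> FEq x y)))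
| EZF_induction x y A : x != y -> ~~ is_free y A -> free_for y x A ->
    EZF (FAll x (FAllIn y x (subst x y A) ==> A) ==> FAll x A)
| EZF_modal_foundation x y A : x != y -> ~~ is_free y A -> free_for y x A ->
    EZF (FBox (FAll x (FBox (FAllIn y x (subst x y A)) ==> A)) ==>
         FBox (FAll x A))
| EZF_pairing x y z u : uniq [:: x; y; z; u] ->
    EZF (FAll x (FAll y (FEx z
      (FBox (FAll u (FMem u z <-> (FEq u x \/ FEq u y)))))))
| EZF_unions x y z v : uniq [:: x; y; z; v] ->
    EZF (FAll x (FEx y
      (FBox (FAll z (FMem z y <-> FEx v (FMem v x /\ FMem z v))))))
| EZF_comprehension x y z A : uniq [:: x; y; z] -> ~~ is_free y A ->
    EZF (FAll x (FEx y (FBox (FAll z (FMem z y <-> (FMem z x /\ A))))))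
| EZF_modal_power_set x y z u : uniq [:: x; y; z; u] ->
    EZF (FAll x (FEx y
      (FBox (FAll z (FMem z y <-> FBox (FAll u (FMem u z ==> FMem u x)))))))
| EZF_infinity u y z v : uniq [:: u; y; z; v] ->
    EZF (FEx u (FBox
      (FExIn y u (FBox (FAll z (~ FMem z y))) /\
       FAllIn y u (FExIn z u (FBox (FAll v (FMem v z <-> (FMem v y \/ FEq v y))))))))
| EZF_modal_collection x y z u A : uniq [:: x; y; z; u] -> ~~ is_free x A ->
    EZF (FBox (FAllIn y u (FEx z A)) ==>
         FEx x (FBox (FAllIn y u (FEx z (FBox (FMem z x /\ A))))))
| EZF_collection x y z u A : uniq [:: x; y; z; u] -> ~~ is_free x A ->
    EZF (FAllIn y u (FEx z A) ==> FEx x (FAllIn y u (FExIn z x A))).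

(* Main.v *)
Require Import Defs.
From mathcomp Require Import all_boot.

(** Over [EZF], stability of membership collapses the modality: [A ==> FBox A]
    becomes provable for every formula [A], and the stability of
    non-membership is the case where [A] is [~ FMem x y].

    The collapse comes from the box in front of the defining equivalence in
    Comprehension.  Let [x] belong to a set [a], and let [b] be the subset of
    [a] cut out by [A], so that
    [FBox (FAll x (FMem x b <-> (FMem x a /\ A)))].  If [A] holds, then [x] is
    in [b]; stability makes [x] necessarily a member of [b]; and since the
    equivalence holds necessarily, so does [A].  Such an [a] always exists by
    Pairing.  Comprehension is thus too strong for any formula about [x] to
    become false later once membership cannot.

    [modal_collapse] carries out this argument, with [exists_elim] to discharge
    the witnesses [a] and [b].  The bound variables of the axiom instances are
    chosen so that most quantifiers are instantiated by their own variable,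
    where substitution does nothing. *)

Lemma subst_refl (x : var) (A : formula) : subst x x A = A.
Proof.
have s_refl z : (if z == x then x else z) = z by case: eqP.
by elim: A => //= [z w|z w|A -> B ->|A -> B ->|A -> B ->|z A ->|z A ->|A ->];
  rewrite ?s_refl // if_same.
Qed.

Lemma free_for_refl (x : var) (A : formula) : free_for x x A.
Proof.
elim: A => //= [A -> B ->|A -> B ->|A -> B ->|z A ->|z A ->] //;
  by rewrite andbT; case: (x != z); rewrite ?orbT.
Qed.

(** A premise-list form of the tautology axiom: it lets one propositional step
    use any number of theorems at once, and its semantic side condition is
    decided by a truth table. *)
Lemma taut_consequence (T : formula -> Prop) (s : nat -> formula)
    (ps : seq pform) (q : pform) :
  (forall v, all (peval v) ps -> peval v q) ->
  foldr (fun p P => provable T (pinst s p) /\ P) True ps ->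
  provable T (pinst s q).
Proof.
elim: ps q => [|p ps IH] q hq /= => [_|[hp hps]].
  by apply/pr_logic/ax_taut => v; apply: hq.
apply: pr_mp hp; apply: (IH (PImp p q)) hps => v hv /=.
by apply/implyP => pv; apply: hq; rewrite /= pv.
Qed.

Lemma imp_trans (T : formula -> Prop) (A B C : formula) :
  provable T (A ==> B)%F -> provable T (B ==> C)%F -> provable T (A ==> C)%F.
Proof.
move=> hAB hBC.
apply: (@taut_consequence T (nth FBot [:: A; B; C])
  [:: PImp (PVar 0) (PVar 1); PImp (PVar 1) (PVar 2)]
  (PImp (PVar 0) (PVar 2))) => // v /=.
by case: (v 0); case: (v 1); case: (v 2).
Qed.

Lemma all_self (T : formula -> Prop) (x : var) (A : formula) :
  provable T (FAll x A ==> A)%F.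
Proof.
by rewrite -{2}(subst_refl x A); apply/pr_logic/ax_all_inst/free_for_refl.
Qed.

Lemma box_mono (T : formula -> Prop) (A B : formula) :
  provable T (A ==> B)%F -> provable T (FBox A ==> FBox B)%F.
Proof. by move=> h; apply: pr_mp (pr_nec h); apply/pr_logic/ax_K. Qed.

(** By contraposition, this is generalization over [(~ B) ==> ~ A]: the
    vacuous-quantifier axiom turns [~ B] into [FAll x (~ B)]. *)
Lemma exists_elim (T : formula -> Prop) (x : var) (A B : formula) :
  ~~ is_free x B ->
  provable T (A ==> B)%F -> provable T (FEx x A ==> B)%F.
Proof.
move=> xB hAB.
have hcontra : provable T ((~ B) ==> ~ A)%F.
  apply: (@taut_consequence T (nth FBot [:: A; B])
    [:: PImp (PVar 0) (PVar 1)]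
    (PImp (PImp (PVar 1) PBot) (PImp (PVar 0) PBot))) => // v /=.
  by case: (v 0); case: (v 1).
have hall : provable T (FAll x (~ B) ==> FAll x (~ A))%F.
  by apply: pr_mp (pr_gen x hcontra); apply/pr_logic/ax_all_imp.
have hvac : provable T (FAll x (~ B) <-> ~ B)%F.
  by apply/pr_logic/ax_all_vacuous; rewrite /= orbF.
have hex := pr_logic T (ax_ex x A).
apply: (@taut_consequence T
  (nth FBot [:: FAll x (~ B)%F; FAll x (~ A)%F; B; FEx x A])
  [:: PImp (PVar 0) (PVar 1);
      PAnd (PImp (PVar 0) (PImp (PVar 2) PBot))
           (PImp (PImp (PVar 2) PBot) (PVar 0));
      PAnd (PImp (PVar 3) (PImp (PVar 1) PBot))
           (PImp (PImp (PVar 1) PBot) (PVar 3))]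
  (PImp (PVar 3) (PVar 2))) => // v /=.
by case: (v 0); case: (v 1); case: (v 2); case: (v 3).
Qed.

Lemma pair_contains_left (T : formula -> Prop) (x y a u : var) :
  uniq [:: x; y; a; u] ->
  provable T (FBox (FAll u (FMem u a <-> (FEq u x \/ FEq u y)))
              ==> FMem x a)%F.
Proof.
rewrite /= !inE !negb_or => /and4P[/and3P[_ _ xu] /andP[_ yu] au _].
pose P := (FMem u a <-> (FEq u x \/ FEq u y))%F.
have inst : provable T
    (FAll u P ==> (FMem x a <-> (FEq x x \/ FEq x y)))%F.
  have -> : (FMem x a <-> (FEq x x \/ FEq x y))%F = subst u x P.
    by rewrite /= eqxx (negPf xu) (negPf yu) (negPf au).
  exact/pr_logic/ax_all_inst.
apply: imp_trans (pr_logic T (ax_T _)) _.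
apply: (@taut_consequence T
  (nth FBot [:: FAll u P; FMem x a; FEq x x; FEq x y])
  [:: PImp (PVar 0)
        (PAnd (PImp (PVar 1) (POr (PVar 2) (PVar 3)))
              (PImp (POr (PVar 2) (PVar 3)) (PVar 1)));
      PVar 2]
  (PImp (PVar 0) (PVar 1))) => [v /=|].
  by case: (v 0); case: (v 1); case: (v 2); case: (v 3).
by split=> //; split=> //; apply/pr_logic/ax_eq_refl.
Qed.

Lemma stable_mem_inst (T : formula -> Prop) (x y b : var) : x != y ->
  provable T (FAll x (FAll y (FMem x y ==> FBox (FMem x y)))) ->
  provable T (FMem x b ==> FBox (FMem x b))%F.
Proof.
move=> xy stab.
have -> : (FMem x b ==> FBox (FMem x b))%F
          = subst y b (FMem x y ==> FBox (FMem x y))%F.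
  by rewrite /= eqxx (negPf xy).
apply: pr_mp (pr_mp (all_self T x _) stab).
exact/pr_logic/ax_all_inst.
Qed.

(** Here [a] is the pair of [x] and [y], used only as some set that contains
    [x], and [b] is the part of [a] cut out by [A]. Comprehension binds [x]
    itself, so that [A] appears in the instance exactly as it stands. *)
Lemma modal_collapse (T : formula -> Prop) (x y a b : var) (A : formula) :
  (forall B, EZF B -> T B) ->
  provable T (FAll x (FAll y (FMem x y ==> FBox (FMem x y)))) ->
  uniq [:: x; y; a; b] -> ~~ is_free a A -> ~~ is_free b A ->
  provable T (A ==> FBox A)%F.
Proof.
move=> EZF_T stab uniq_xyab aA bA.
have := uniq_xyab; rewrite /= !inE !negb_or.
move=> /and4P[/and3P[xy xa xb] /andP[ya yb] ab _].
pose M := FMem x b; pose E := FMem x a.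
pose D := (M <-> (E /\ A))%F.
have stabM : provable T (M ==> FBox M)%F := stable_mem_inst T x y b xy stab.
have boxD_A : provable T (FBox D ==> (FBox M ==> FBox A))%F.
  apply: imp_trans (pr_logic T (ax_K M A)); apply: box_mono.
  apply: (@taut_consequence T (nth FBot [:: M; E; A]) [::]
    (PImp (PAnd (PImp (PVar 0) (PAnd (PVar 1) (PVar 2)))
                (PImp (PAnd (PVar 1) (PVar 2)) (PVar 0)))
          (PImp (PVar 0) (PVar 2)))) => // v _ /=.
  by case: (v 0); case: (v 1); case: (v 2).
have collapseD : provable T (FBox D ==> (E ==> (A ==> FBox A)))%F.
  apply: (@taut_consequence T
    (nth FBot [:: FBox D; M; E; A; FBox M; FBox A])
    [:: PImp (PVar 0)
          (PAnd (PImp (PVar 1) (PAnd (PVar 2) (PVar 3)))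
                (PImp (PAnd (PVar 2) (PVar 3)) (PVar 1)));
        PImp (PVar 1) (PVar 4);
        PImp (PVar 0) (PImp (PVar 4) (PVar 5))]
    (PImp (PVar 0) (PImp (PVar 2) (PImp (PVar 3) (PVar 5))))) => [v /=|].
    by case: (v 0); case: (v 1); case: (v 2); case: (v 3); case: (v 4);
       case: (v 5).
  by split; [apply/pr_logic/ax_T | do 2!split=> //].
have subset_ex : provable T (FEx b (FBox (FAll x D))).
  apply: pr_mp (all_self T a _) _.
  apply/pr_axiom/EZF_T/EZF_comprehension => //.
  by rewrite /= !inE negb_or ab eq_sym xa eq_sym xb.
have mem_collapse : provable T (E ==> (A ==> FBox A))%F.
  apply: pr_mp subset_ex; apply: exists_elim.
    by rewrite /= (eq_sym b) (negPf xb) (eq_sym b) (negPf ab) (negPf bA).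
  exact: imp_trans (box_mono _ _ _ (all_self T x D)) collapseD.
(* [b] has been discharged, so it can serve as the bound variable here. *)
have pair_ex : provable T
    (FEx a (FBox (FAll b (FMem b a <-> (FEq b x \/ FEq b y)))))%F.
  apply: pr_mp (all_self T y _) _; apply: pr_mp (all_self T x _) _.
  exact/pr_axiom/EZF_T/EZF_pairing.
apply: pr_mp pair_ex; apply: exists_elim; first by rewrite /= (negPf aA).
exact: imp_trans (pair_contains_left T x y a b uniq_xyab) mem_collapse.
Qed.

Theorem proposition1p3 (x y : var) (hxy : x != y) :
  provable
    (extend EZF (FBox (FAll x (FAll y (FMem x y ==> FBox (FMem x y))))))
    (FBox (FAll x (FAll y ((~ FMem x y) ==> FBox (~ FMem x y)))))%F.
Proof.
set T := extend _ _.
have stab : provable T (FAll x (FAll y (FMem x y ==> FBox (FMem x y)))).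
  by apply: pr_mp (pr_logic T (ax_T _)) _; apply: pr_axiom; right.
(* The two variables just above [x] and [y] are fresh for the formula. *)
have lt_xa : x < (maxn x y).+1 by rewrite ltnS leq_maxl.
have lt_ya : y < (maxn x y).+1 by rewrite ltnS leq_maxr.
have fresh : uniq [:: x; y; (maxn x y).+1; (maxn x y).+2].
  rewrite /= !inE !negb_or hxy.
  by rewrite !ltn_eqF // ltnW.
apply/pr_nec/pr_gen/pr_gen/(modal_collapse _ _ _ _ _ _ _ stab fresh); first by left.
  by rewrite /= !(eq_sym _.+1) !ltn_eqF.
by rewrite /= !(eq_sym _.+2) !ltn_eqF // ltnW.
Qed.
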